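(* Let $\hat m,\hat n\in S^2$ with $\hat m^{\mathrm T}\hat n\in[0,1)$, let $\alpha,\gamma\in\mathbb R$ and $\beta\in[0,\pi]$, and put $\delta=\arccos\hat m^{\mathrm T}\hat n\in(0,\pi/2]$ and $\hat l=\|\hat m\times\hat n\|^{-1}\,\hat m\times\hat n$. Let $k\in\mathbb N$ and $\beta_1,\dots,\beta_k\in(0,2\delta]$ satisfy $\beta=\beta_1+\cdots+\beta_k$. Let $t_1,\dots,t_k\in\mathbb R$ be arbitrary and, for $j=1,\dots,k$, put $$\alpha_j=H_{t_j}(\beta_j,\delta)-\frac\pi2,\qquad \gamma_j=H_{t_j}(\beta_j,\delta)+\frac\pi2,\qquad \theta_j=2\arcsin\frac{\sin(\beta_j/2)}{\sin\delta}.$$ Then $$R_{\hat l}(\beta_j)=R_{\hat m}(-\alpha_j)R_{\hat n}(\theta_j)R_{\hat m}(-\gamma_j)\qquad (j=1,\dots,k),$$ and $$R_{\hat m}(\alpha)R_{\hat l}(\beta)R_{\hat m}(\gamma)=R_{\hat m}(\alpha-\alpha_1)R_{\hat n}(\theta_1)\,R_{\hat m}(-\gamma_1-\alpha_2)R_{\hat n}(\theta_2)\cdots R_{\hat m}(-\gamma_{k-1}-\alpha_k)R_{\hat n}(\theta_k)\,R_{\hat m}(-\gamma_k+\gamma).$$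
   Context: $\mathbb N$ is the set of strictly positive integers; $S^2=\{\hat v\in\mathbb R^3:\|\hat v\|=1\}$; $\arccos$ takes values in $[0,\pi]$ and $\arcsin$ in $[-\pi/2,\pi/2]$. $I$ is the $2\times2$ identity matrix and $X=\begin{pmatrix}0&1\\1&0\end{pmatrix}$, $Y=\begin{pmatrix}0&-i\\i&0\end{pmatrix}$, $Z=\begin{pmatrix}1&0\\0&-1\end{pmatrix}$. For $\hat v=(v_x,v_y,v_z)^{\mathrm T}\in S^2$ and $\theta\in\mathbb R$, $$R_{\hat v}(\theta)=(\cos\tfrac\theta2)I-i(\sin\tfrac\theta2)(v_xX+v_yY+v_zZ)\in \mathrm{SU}(2).$$ For real $\beta,\delta$ with $0\le\beta/2\le\delta\le\pi/2$, $\delta\ne0$, and $t\in\mathbb R$: $H_t(\beta,\delta)=0$ if $\beta/2<\delta=\pi/2$; $H_t(\beta,\delta)=t$ if $\beta/2=\delta=\pi/2$; and $H_t(\beta,\delta)=\arcsin\frac{\tan(\beta/2)}{\tan\delta}$ otherwise. *)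

(* Defs.v *)
From HB Require Import structures.
From mathcomp Require Import all_boot all_order all_algebra.
From mathcomp Require Import complex.
From mathcomp Require Import reals trigo.

Set Implicit Arguments.
Unset Strict Implicit.
Unset Printing Implicit Defensive.

Import Order.TTheory GRing.Theory Num.Theory.

Local Open Scope ring_scope.
Local Open Scope complex_scope.

(* Vectors of R^3 are columns; the indices 0, 1, 2 stand for x, y, z. *)
Definition dot3 (R : realType) (u v : 'cV[R]_3) : R := (u^T *m v) 0 0.

(* The norm that mathcomp-analysis puts on matrices is the sup norm. *)
Definition norm3 (R : realType) (v : 'cV[R]_3) : R := Num.sqrt (dot3 v v).

Definition cross3 (R : realType) (u v : 'cV[R]_3) : 'cV[R]_3 :=
  \col_(i < 3)
    [:: u 1 0 * v 2 0 - u 2 0 * v 1 0;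
        u 2 0 * v 0 0 - u 0 0 * v 2 0;
        u 0 0 * v 1 0 - u 1 0 * v 0 0]`_i.

Definition sphere2 (R : realType) (v : 'cV[R]_3) : Prop := norm3 v = 1.

Definition mx22 (T : Type) (a b c d : T) : 'M[T]_2 :=
  \matrix_(i < 2, j < 2)
    if i == 0 then (if j == 0 then a else b) else (if j == 0 then c else d).

Definition pauliX (R : realType) : 'M[R[i]]_2 := mx22 0 1 1 0.
Definition pauliY (R : realType) : 'M[R[i]]_2 := mx22 0 (- 'i) 'i 0.
Definition pauliZ (R : realType) : 'M[R[i]]_2 := mx22 1 0 0 (- 1).

Definition rotation (R : realType) (v : 'cV[R]_3) (theta : R) : 'M[R[i]]_2 :=
  (cos (theta / 2))%:C *: 1%:M
  - ('i * (sin (theta / 2))%:C) *: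
      ((v 0 0)%:C *: pauliX R + (v 1 0)%:C *: pauliY R
       + (v 2 0)%:C *: pauliZ R).

(* H_t(beta, delta), meant for 0 <= beta / 2 <= delta <= pi / 2 and
   delta != 0; its values elsewhere are irrelevant. *)
Definition Hfun (R : realType) (t beta delta : R) : R :=
  if (beta / 2 < delta) && (delta == pi / 2) then 0
  else if (beta / 2 == delta) && (delta == pi / 2) then t
  else asin (tan (beta / 2) / tan delta).

(* Main.v *)
(* Write M, N, L for the traceless Hermitian matrices attached to m, n, l.
   Conjugation by R_m(pi/2) turns n = c m + s p into
   c m + s l (c = cos delta, s = sin delta, p = l x m), and L anticommutes with M, so
   R_m(pi/2 - h) R_n(theta) R_m(- pi/2 - h)
     = R_m(-2h) (cos(theta/2) - i c sin(theta/2) M) - i s sin(theta/2) L.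
   The angle theta makes the L-part that of R_l(beta), and h = H_t(beta, delta)
   makes the remaining factor equal to cos(beta/2). The long product follows by
   splitting R_l(beta) and merging adjacent rotations about m. *)
Require Import Defs.
From HB Require Import structures.
From mathcomp Require Import all_boot all_order all_algebra.
From mathcomp Require Import complex.
From mathcomp Require Import reals trigo ring lra.

Set Implicit Arguments.
Unset Strict Implicit.
Unset Printing Implicit Defensive.

Import Order.TTheory GRing.Theory Num.Theory.

Local Open Scope ring_scope.

(** By induction: the trailing [rho (- G _)] of one factor and the leading [rho (- A _)] of the next
    fuse into one value of [rho]. With [k.+1] factors, a first one to absorb [rho a] always
    exists. *)
Lemma prod_merge (V : zmodType) (S : pzRingType) (rho : V -> S)
    (a : V) (A G : nat -> V) (F : nat -> S) k :
  (forall x y, rho (x + y) = rho x * rho y) ->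
  rho a * \prod_(1 <= j < k.+2) (rho (- A j) * F j * rho (- G j)) =
  rho (a - A 1%N) * F 1%N
    * (\prod_(2 <= j < k.+2) (rho (- G j.-1 - A j) * F j)) * rho (- G k.+1).
Proof.
move=> rhoD; elim: k => [|k IH].
  by rewrite big_nat1 big_geq // mulr1 rhoD !mulrA.
rewrite (big_nat_recr k.+2) // [in RHS](big_nat_recr k.+2) //=.
by rewrite mulrA IH (rhoD (- G k.+1)) !mulrA.
Qed.

Section Quaternions.
Local Open Scope complex_scope.
Variable R : realType.
Implicit Types (u v : 'cV[R]_3) (a b : R).

(* The quaternion a I - i (v_x X + v_y Y + v_z Z). *)
Definition quat a v : 'M[R[i]]_2 :=
  mx22 (a -i* v 2 0) (- v 1 0 -i* v 0 0) (v 1 0 -i* v 0 0) (a +i* v 2 0).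

Lemma rotation_quat v a :
  rotation v a = quat (cos (a / 2)) (sin (a / 2) *: v).
Proof.
rewrite /rotation /quat; move: (cos _) (sin _) => x y.
apply/matrixP => i j; rewrite !mxE.
by case: i => [[|[|//]] ?]; case: j => [[|[|//]] ?];
  rewrite /=; simpc; rewrite ?mulrN.
Qed.

Lemma dot3E u v :
  dot3 u v = u 0 0 * v 0 0 + u 1 0 * v 1 0 + u 2 0 * v 2 0.
Proof.
rewrite /dot3 mxE !big_ord_recl big_ord0 !mxE addr0 addrA.
by congr (_ * _ + _ * _ + _ * _); congr (_ _ _); apply/val_inj.
Qed.

Lemma cross3E u v : (cross3 u v 0 0 = u 1 0 * v 2 0 - u 2 0 * v 1 0) *
  (cross3 u v 1 0 = u 2 0 * v 0 0 - u 0 0 * v 2 0) *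
  (cross3 u v 2 0 = u 0 0 * v 1 0 - u 1 0 * v 0 0).
Proof. by rewrite !mxE. Qed.

Lemma eq_cV3 u v :
  u 0 0 = v 0 0 -> u 1 0 = v 1 0 -> u 2 0 = v 2 0 -> u = v.
Proof.
move=> h0 h1 h2; apply/colP => -[[|[|[|//]]] p].
- by have -> : Ordinal p = 0 by apply/val_inj.
- by have -> : Ordinal p = 1 by apply/val_inj.
- by have -> : Ordinal p = 2 by apply/val_inj.
Qed.

(** From (u.sigma)(v.sigma) = (u.v) I + i (u x v).sigma, where sigma = (X, Y, Z). *)
Lemma quat_mul a b u v : quat a u *m quat b v =
  quat (a * b - dot3 u v) (a *: v + b *: u + cross3 u v).
Proof.
have vE i w : (a *: v + b *: u + w) i 0 = a * v i 0 + b * u i 0 + w i 0.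
  by rewrite !mxE.
rewrite /quat dot3E !vE !cross3E; apply/matrixP => i j.
rewrite !mxE big_ord_recl big_ord1 !mxE.
case: i => [[|[|//]] ?]; case: j => [[|[|//]] ?];
  rewrite /=; simpc; congr (_ +i* _); ring.
Qed.

(** The double product (u x v) x u = (u.u) v - (u.v) u keeps the vector part in the span of u, v and
    u x v. *)
Lemma quat_conj u v x1 x2 x3 y1 y2 y3 :
  quat x1 (y1 *: u) *m quat x2 (y2 *: v) *m quat x3 (y3 *: u) =
  quat (x2 * (x1 * x3 - dot3 u u * y1 * y3)
        - y2 * dot3 u v * (x1 * y3 + y1 * x3))
    ((x2 * (x1 * y3 + y1 * x3) - 2 * dot3 u v * y1 * y2 * y3) *: u
     + (y2 * (x1 * x3 + dot3 u u * y1 * y3)) *: v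
     + (y2 * (y1 * x3 - x1 * y3)) *: cross3 u v).
Proof.
rewrite !quat_mul !dot3E; congr quat; first by rewrite !mxE /=; ring.
by apply: eq_cV3; rewrite !mxE /=; ring.
Qed.

(** Lagrange's identity; for unit vectors it yields the squared sine of their angle. *)
Lemma dot3_cross u v :
  dot3 (cross3 u v) (cross3 u v) = dot3 u u * dot3 v v - dot3 u v ^+ 2.
Proof. by rewrite !dot3E !cross3E; ring. Qed.

Lemma dot3Z a b u v : dot3 (a *: u) (b *: v) = a * b * dot3 u v.
Proof. by rewrite !dot3E !mxE; ring. Qed.

Lemma cross3Z a b u : cross3 (a *: u) (b *: u) = 0.
Proof. by apply: eq_cV3; rewrite cross3E !mxE; ring. Qed.

Lemma dot3_ge0 v : 0 <= dot3 v v.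
Proof. by rewrite dot3E !addr_ge0 // -expr2 sqr_ge0. Qed.

Lemma sphere2E v : sphere2 v -> dot3 v v = 1.
Proof.
rewrite /sphere2 /norm3 => h.
by rewrite -(sqr_sqrtr (dot3_ge0 v)) h expr1n.
Qed.

(** Parallel vectors have zero cross product, which leaves the addition formulas of cos and sin. *)
Lemma rotationD v a b : dot3 v v = 1 ->
  rotation v (a + b) = rotation v a *m rotation v b.
Proof.
move=> v1; rewrite !rotation_quat quat_mul dot3Z cross3Z v1 addr0 mulr1.
rewrite mulrDl cosD sinD !scalerA -scalerDl; congr (quat _ (_ *: _)); ring.
Qed.

Lemma rotation0 v : rotation v 0 = 1%:M.
Proof.
by rewrite /rotation mul0r cos0 sin0 mulr0 scale0r subr0 scale1r.
Qed.

Lemma rotation_sum v (F : nat -> R) k : dot3 v v = 1 ->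
  rotation v (\sum_(1 <= j < k.+1) F j) =
  \prod_(1 <= j < k.+1) rotation v (F j).
Proof.
move=> v1; elim: k => [|k IH]; first by rewrite !big_geq // rotation0.
by rewrite !(big_nat_recr k.+1) //= rotationD // IH.
Qed.

(* The first two equations say that exp(i h U) (cos t - i c sin t U) = cos b, where U^2 = 1. *)
Lemma rotation_conj u v (b h t r : R) : dot3 u u = 1 -> r != 0 ->
  cos t * cos h + sin t * dot3 u v * sin h = cos b ->
  cos t * sin h = sin t * dot3 u v * cos h ->
  sin t * r = sin b ->
  rotation (r^-1 *: cross3 u v) (2 * b) =
  rotation u (- (h - pi / 2)) *m rotation v (2 * t)
    *m rotation u (- (h + pi / 2)).
Proof.
move=> u1 r0 e1 e2 e3; rewrite !rotation_quat quat_conj u1.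
have half x : 2 * x / 2 = x :> R by field.
rewrite !half {half}.
(* Half angles of the outer rotations. The coefficient of v carries the factor cos(A - B) = 0, that
   of u x v the factor sin(A - B) = 1. *)
set A := - (h - pi / 2) / 2; set B := - (h + pi / 2) / 2.
have sD : A + B = - h by rewrite /A /B; field.
have sB : A - B = pi / 2 by rewrite /A /B; field.
have cD : cos A * cos B - sin A * sin B = cos h by rewrite -cosD sD cosN.
have sinDE : cos A * sin B + sin A * cos B = - sin h.
  by rewrite -sinN -sD sinD addrC.
have cB : cos A * cos B + sin A * sin B = 0 by rewrite -cosB sB cos_pihalf.
have sinBE : sin A * cos B - cos A * sin B = 1.
  by rewrite -sinB sB sin_pihalf.
rewrite !mul1r cD sinDE cB sinBE mulr0 mulr1 scale0r addr0 -e1 -e3.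
(* The coefficient of u vanishes by [e2], since 2 sin A sin B = cos(A - B) - cos(A + B) = - cos
   h. *)
have -> : cos t * - sin h - 2 * dot3 u v * sin A * sin t * sin B = 0.
  have ss : 2 * (sin A * sin B) = - cos h by lra.
  rewrite mulrN e2 -[cos h]opprK -ss; ring.
rewrite scale0r add0r !scalerA; congr quat; first by ring.
by rewrite mulfK.
Qed.

(* h and th satisfy the hypotheses of [rotation_conj]. When acos c = pi / 2 = b
   the value of h is arbitrary because cos th = c = 0. *)
Lemma Hfun_eqs (t b c : R) : 0 <= c < 1 -> 0 < b <= acos c ->
  let h := Hfun t (2 * b) (acos c) in
  let th := asin (sin b / sin (acos c)) in
  [/\ cos th * cos h + sin th * c * sin h = cos b,
      cos th * sin h = sin th * c * cos h
    & sin th * sin (acos c) = sin b].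
Proof.
move=> /andP[c0 c1] /andP[b0 bd] h th.
have pi0 := pi_gt0 R.
have c11 : -1 <= c <= 1 by apply/andP; split; lra.
have cosd : cos (acos c) = c by rewrite acosK // in_itv.
have sind : sin (acos c) = Num.sqrt (1 - c ^+ 2) by rewrite sin_acos.
have dle : acos c <= pi / 2.
  rewrite leNgt; apply/negP => hlt.
  have : cos (acos c) < cos (pi / 2).
    by rewrite ltr_cos // in_itv /= ?acos_ge0 ?acos_lepi //; apply/andP; split; lra.
  by rewrite cosd cos_pihalf; lra.
set d := acos c in bd cosd sind dle h th *.
have s0 : 0 < sin d by apply: sin_gt0_pi; apply/andP; split; lra.
have sb0 : 0 < sin b by apply: sin_gt0_pi; apply/andP; split; lra.
(* Monotonicity of sin on [-pi/2, pi/2]; this puts the argument of [asin] in [th] below 1. *)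
have sbd : sin b <= sin d.
  rewrite leNgt; apply/negP; rewrite ltr_sin ?in_itv /=; first by lra.
    by apply/andP; split; lra.
  by apply/andP; split; lra.
have s2 := cos2Dsin2 d; rewrite cosd in s2.
have b2 := cos2Dsin2 b.
rewrite {}/h {}/th; set r := sin b / sin d.
have rs : r * sin d = sin b by rewrite /r divfK // gt_eqF.
have r0 : 0 < r by rewrite divr_gt0.
have r1 : r <= 1 by rewrite ler_pdivrMr // mul1r.
have r11 : -1 <= r <= 1 by apply/andP; split; lra.
have sinr : sin (asin r) = r by rewrite asinK // in_itv.
have cosr := cos_asin r11.
have cosr0 : 0 <= cos (asin r) by rewrite cosr sqrtr_ge0.
have cosr2 : cos (asin r) ^+ 2 = 1 - r ^+ 2.
  by rewrite cosr sqr_sqrtr // subr_ge0 expr_le1 // ltW.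
rewrite sinr /Hfun.
have -> : 2 * b / 2 = b by field.
move: (cos (asin r)) cosr0 cosr2 => q q0 q2 {cosr sinr}.
(* Here q = cos th and r = sin th. The vector (q, r c) has length cos b, and h is its polar angle
   unless it vanishes. *)
have qb : q ^+ 2 + r ^+ 2 * c ^+ 2 = cos b ^+ 2.
  have -> : cos b ^+ 2 = 1 - (r * sin d) ^+ 2 by rewrite rs -b2; ring.
  have -> : c ^+ 2 = 1 - sin d ^+ 2 by rewrite -s2; ring.
  by rewrite q2; ring.
have cb0 : 0 <= cos b by apply: cos_ge0_pihalf; apply/andP; split; lra.
(* If d = pi/2, the vector is (cos b, 0): either b < d and h = 0, or b = d and it vanishes, so that
   h is free. *)
have [dpi|dpi] := eqVneq d (pi / 2).
  have c_eq0 : c = 0 by rewrite -cosd dpi cos_pihalf.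
  have qE : q = cos b.
    by apply/eqP; rewrite -(eqrXn2 (n := 2)) // -qb c_eq0; apply/eqP; ring.
  rewrite c_eq0 !mulr0 !mul0r addr0 andbT qE; split=> //.
  - have [_|hb] := ltP b d; first by rewrite cos0 mulr1.
    have -> : b = pi / 2 by lra.
    by rewrite cos_pihalf mul0r.
  - have [_|hb] := ltP b d; first by rewrite sin0 mulr0.
    have -> : b = pi / 2 by lra.
    by rewrite cos_pihalf mul0r.
rewrite !andbF.
have dlt : d < pi / 2 by rewrite lt_neqAle dpi.
have cgt0 : 0 < c.
  by rewrite -cosd; apply: cos_gt0_pihalf; apply/andP; split; lra.
have cb : 0 < cos b by apply: cos_gt0_pihalf; apply/andP; split; lra.
have cbN : cos b != 0 by rewrite gt_eqF.
(* Substituting sin b = r sin d shows that sin h = r c / cos b; then cos h = q / cos b, as both q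
   and cos b are nonnegative. *)
have -> : tan b / tan d = r * c / cos b.
  by rewrite /tan cosd -rs; field; rewrite cbN !gt_eqF.
have z0 : 0 <= r * c / cos b by rewrite divr_ge0 // mulr_ge0 // ltW.
have z2 : 1 - (r * c / cos b) ^+ 2 = (q / cos b) ^+ 2.
  have -> : (q / cos b) ^+ 2 = q ^+ 2 / cos b ^+ 2 by field.
  by have -> : q ^+ 2 = cos b ^+ 2 - r ^+ 2 * c ^+ 2; [rewrite -qb; ring|field].
have z1 : r * c / cos b <= 1.
  by rewrite -(expr_le1 (n := 2)) // -subr_ge0 z2 sqr_ge0.
have z11 : -1 <= r * c / cos b <= 1 by apply/andP; split; lra.
rewrite cos_asin // asinK ?in_itv // z2 sqrtr_sqr ger0_norm ?divr_ge0 //.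
split=> //; last by field.
by rewrite -[RHS](mulfK cbN) -expr2 -qb; field.
Qed.

End Quaternions.

Theorem mainTheorem4 (R : realType) (m n : 'cV[R]_3) (alpha gamma beta : R)
    (k : nat) (beta_ t_ : nat -> R) :
  sphere2 m -> sphere2 n ->
  0 <= dot3 m n < 1 ->
  0 <= beta <= pi ->
  let delta := acos (dot3 m n) in
  let l := (norm3 (cross3 m n))^-1 *: cross3 m n in
  (0 < k)%N ->
  (forall j : nat, (1 <= j <= k)%N -> 0 < beta_ j <= 2 * delta) ->
  beta = \sum_(1 <= j < k.+1) beta_ j ->
  let alpha_ := fun j : nat => Hfun (t_ j) (beta_ j) delta - pi / 2 in
  let gamma_ := fun j : nat => Hfun (t_ j) (beta_ j) delta + pi / 2 in
  let theta_ := fun j : nat => 2 * asin (sin (beta_ j / 2) / sin delta) in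
  (forall j : nat, (1 <= j <= k)%N ->
     rotation l (beta_ j)
     = rotation m (- alpha_ j) *m rotation n (theta_ j)
       *m rotation m (- gamma_ j))
  /\
  rotation m alpha *m rotation l beta *m rotation m gamma
  = rotation m (alpha - alpha_ 1%N) *m rotation n (theta_ 1%N)
    *m (\prod_(2 <= j < k.+1)
          (rotation m (- gamma_ j.-1 - alpha_ j) *m rotation n (theta_ j)))
    *m rotation m (- gamma_ k + gamma).
Proof.
move=> /sphere2E m1 /sphere2E n1 c01 _ delta l k0 hb -> alpha_ gamma_ theta_.
have [c0 c1] := andP c01.
have lE : norm3 (cross3 m n) = sin delta.
  rewrite /norm3 dot3_cross m1 n1 mulr1 sin_acos //; apply/andP; split; lra.
have s0 : sin delta != 0.
  rewrite -lE sqrtr_eq0 -ltNge dot3_cross m1 n1 mulr1 subr_gt0.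
  by rewrite expr_lt1.
have l1 : dot3 l l = 1.
  rewrite /l dot3Z lE dot3_cross m1 n1 mulr1.
  have := cos2Dsin2 delta; rewrite acosK ?in_itv /=; last by apply/andP; split; lra.
  by move=> h; rewrite -[1 - _](_ : sin delta ^+ 2 = _); [field|lra].
have step j : (1 <= j <= k)%N -> rotation l (beta_ j) =
    rotation m (- alpha_ j) *m rotation n (theta_ j) *m rotation m (- gamma_ j).
  move=> /hb /andP[b0 b2]; have bE : beta_ j = 2 * (beta_ j / 2) by field.
  have hb2 : 0 < beta_ j / 2 <= delta by apply/andP; split; lra.
  have [e1 e2 e3] := Hfun_eqs (t_ j) c01 hb2; rewrite -bE in e1 e2.
  rewrite /l lE [in LHS]bE; exact: rotation_conj m1 s0 e1 e2 e3.
split; first exact: step.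
(* Writing the positive k as a successor gives the product the shape required by [prod_merge]. *)
case: k k0 {hb} step => [k0|k _ step]; first by discriminate k0.
have mD x y := rotationD x y m1.
rewrite (rotation_sum _ _ l1) mulmxE.
rewrite (eq_big_nat _ _ (F2 := fun j => rotation m (- alpha_ j)
  * rotation n (theta_ j) * rotation m (- gamma_ j))); last exact: step.
rewrite (prod_merge alpha alpha_ gamma_ (fun j => rotation n (theta_ j)) k mD).
(* The last merged rotation is split to expose the factor R_m(gamma) on the right. *)
by rewrite (mD (- gamma_ k.+1)) !mulrA.
Qed.
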